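(* Let $\mathcal{T}$ be a temporally connected temporal tree. Then the two-player temporal diffusion game $\mathrm{Diff}(\mathcal{T},2)$ contains a Nash equilibrium, and such a Nash equilibrium can be computed in linear time.
   Context: A temporal graph $\mathcal{G}=(V,(E_t)_{t=1}^\infty)$ consists of a finite vertex set $V$ and edge sets $E_t\subseteq\binom{V}{2}$; its $t$-th layer is $G_t=(V,E_t)$. It is assumed to have finite lifetime, i.e. there is $\tau$ with $E_t=E_\tau$ for all $t\ge\tau$ (the least such $\tau$ is the lifetime). The underlying graph is $(V,\bigcup_t E_t)$. A temporal tree is a temporal graph whose underlying graph is a tree. A temporal walk from $v_0$ to $v_d$ is a sequence $(\{v_0,v_1\},t_1),\dots,(\{v_{d-1},v_d\},t_d)$ with $t_1<t_2<\dots<t_d$ and $\{v_{i-1},v_i\}\in E_{t_i}$ for all $i$; its arrival time is $t_d$. $\mathrm{td}(u,v)$ is the smallest arrival time of a temporal walk from $u$ to $v$ ($\infty$ if none exists, and $\mathrm{td}(v,v)=0$). $\mathcal{G}$ is temporally connected if $\mathrm{td}(u,v)<\infty$ for all $u,v\in V$. Two-player temporal diffusion game $\mathrm{Diff}(\mathcal{G},2)$: players $1,2$ choose vertices $p_1,p_2\in V$ simultaneously. At time $0$, if $p_1\ne p_2$ then $p_i$ gets color $i$; if $p_1=p_2$ this vertex is colored gray. For $t=1,2,\dots$, in step $t$ each uncolored vertex having a neighbor in $G_t$ of color $i\in\{1,2\}$ and no neighbor in $G_t$ of the other player's color gets color $i$; each uncolored vertex having neighbors in $G_t$ of both colors $1$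 and $2$ becomes gray. Gray does not spread, and colors never change. The payoff of player $i$ is the final number of vertices of color $i$. A profile $(p_1,p_2)$ is a Nash equilibrium if no player can strictly increase her payoff by unilaterally choosing another vertex. *)

(* Defs.v *)
From HB Require Import structures.
From mathcomp Require Import all_boot.
From mathcomp Require Import boolp.
Set Implicit Arguments.
Unset Strict Implicit.
Unset Printing Implicit Defensive.

(** * Temporal graphs *)

Definition stabilises (V : finType) (E : nat -> rel V) (tau : nat) : Prop :=
  0 < tau /\ forall t, tau <= t -> E t =2 E tau.

(* Layers are indexed from 1 on; [layer 0] is never looked at. *)
Record temporal_graph (V : finType) := TemporalGraph {
  layer :> nat -> rel V;
  layer_sym : forall t, symmetric (layer t);
  layer_irr : forall t, irreflexive (layer t);
  layer_fin : exists tau, stabilises layer tau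
}.

Section TemporalGraphs.
Variables (V : finType) (G : temporal_graph V).

Definition is_lifetime (tau : nat) : Prop :=
  stabilises G tau /\ forall sigma, stabilises G sigma -> tau <= sigma.

Definition underlying : rel V :=
  fun u v => `[< exists t, 0 < t /\ G t u v >].

(* A walk u = v_0, v_1, ..., v_d with times t_1 < ... < t_d is the sequence of
   the pairs (v_i, t_i), 1 <= i <= d. Starting the path at time 0 forces
   0 < t_1, and the empty walk has arrival time 0, whence td v v = 0. *)
Definition temporal_walk (u : V) (w : seq (V * nat)) : bool :=
  path (fun x y => (x.2 < y.2) && G y.2 x.1 y.1) (u, 0) w.

Definition walk_end (u : V) (w : seq (V * nat)) : V := (last (u, 0) w).1.
Definition arrival_time (u : V) (w : seq (V * nat)) : nat := (last (u, 0) w).2.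

Definition arrives (u v : V) (a : nat) : Prop :=
  exists w, [/\ temporal_walk u w, walk_end u w = v & arrival_time u w = a].

(* [None] stands for infinity. *)
Definition td (u v : V) : option nat :=
  if pselect (exists a, `[< arrives u v a >]) is left ex_a
  then Some (ex_minn ex_a) else None.

Definition temporally_connected : Prop := forall u v, td u v <> None.

End TemporalGraphs.

Definition is_tree (V : finType) (e : rel V) : Prop :=
  [/\ 0 < #|V|,
      forall u v, connect e u v &
      forall c : seq V, 2 < size c -> ~~ ucycleb e c].

Definition temporal_tree (V : finType) (G : temporal_graph V) : Prop :=
  is_tree (underlying G).

(** * The two-player temporal diffusion game *)

Inductive colour := Colour1 | Colour2 | Gray.

Definition colour_eq (a b : colour) : bool :=
  match a, b with
  | Colour1, Colour1 | Colour2, Colour2 | Gray, Gray => true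
  | _, _ => false
  end.

Lemma colour_eqP : Equality.axiom colour_eq.
Proof. by case; case; constructor. Qed.

HB.instance Definition _ := hasDecEq.Build colour colour_eqP.

Section Diffusion.
Variables (V : finType) (G : temporal_graph V).

(* [None] means uncoloured. *)
Definition colouring := V -> option colour.

Definition start (p1 p2 : V) : colouring := fun v =>
  if p1 == p2 then (if v == p1 then Some Gray else None)
  else if v == p1 then Some Colour1
  else if v == p2 then Some Colour2
  else None.

Definition has_neighbour (t : nat) (col : colouring) (k : colour) (v : V) :=
  [exists u, G t v u && (col u == Some k)].

Definition step (t : nat) (col : colouring) : colouring := fun v =>
  if col v is Some k then Some k
  else match has_neighbour t col Colour1 v, has_neighbour t col Colour2 v with
       | true, true => Some Gray
       | true, false => Some Colour1
       | false, true => Some Colour2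
       | false, false => None
       end.

Fixpoint diffusion (p1 p2 : V) (t : nat) : colouring :=
  if t is t'.+1 then step t (diffusion p1 p2 t') else start p1 p2.

(* Colours never change, so the vertices that finally have colour k are those
   that have colour k at some time. *)
Definition final_count (k : colour) (p1 p2 : V) : nat :=
  #|[set v | `[< exists t, diffusion p1 p2 t v = Some k >]]|.

Definition payoff1 (p1 p2 : V) : nat := final_count Colour1 p1 p2.
Definition payoff2 (p1 p2 : V) : nat := final_count Colour2 p1 p2.

Definition nash_equilibrium (p1 p2 : V) : Prop :=
  (forall q, payoff1 q p2 <= payoff1 p1 p2) /\
  (forall q, payoff2 p1 q <= payoff2 p1 p2).

End Diffusion.

(** * Running time: a unit-cost word RAM, programmed with while programs *)

(* Programs use a fixed finite set of registers and of arrays, both named by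
   literals of the program text; only array indices are computed. *)
Inductive expr :=
  | Num of nat
  | Var of nat
  | Get of nat & expr
  | Add of expr & expr
  | Sub of expr & expr
  | Eq of expr & expr
  | Lt of expr & expr.

Inductive cmd :=
  | Skip
  | Assign of nat & expr
  | Put of nat & expr & expr
  | Seq of cmd & cmd
  | If of expr & cmd & cmd
  | While of expr & cmd.

Record store := Store {
  var : nat -> nat;
  arr : nat -> nat -> nat
}.

Definition set_var (s : store) (x n : nat) : store :=
  Store (fun y => if y == x then n else var s y) (arr s).

Definition set_arr (s : store) (a i n : nat) : store :=
  Store (var s)
    (fun b j => if (b == a) && (j == i) then n else arr s b j).

(* Machine words are the numbers below W; literals and sums wrap around,
   whereas subtraction is truncated at 0. *)
Fixpoint eval (W : nat) (s : store) (e : expr) : nat :=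
  match e with
  | Num n => n %% W
  | Var x => var s x
  | Get a e1 => arr s a (eval W s e1)
  | Add e1 e2 => (eval W s e1 + eval W s e2) %% W
  | Sub e1 e2 => eval W s e1 - eval W s e2
  | Eq e1 e2 => eval W s e1 == eval W s e2
  | Lt e1 e2 => eval W s e1 < eval W s e2
  end.

Fixpoint expr_cost (e : expr) : nat :=
  match e with
  | Num _ | Var _ => 1
  | Get _ e1 => (expr_cost e1).+1
  | Add e1 e2 | Sub e1 e2 | Eq e1 e2 | Lt e1 e2 =>
      (expr_cost e1 + expr_cost e2).+1
  end.

(* [exec W c s k s']: started in s, the program c halts in s' after k unit
   steps. *)
Inductive exec (W : nat) : cmd -> store -> nat -> store -> Prop :=
  | ExecSkip s : exec W Skip s 1 s
  | ExecAssign x e s :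
      exec W (Assign x e) s (expr_cost e).+1 (set_var s x (eval W s e))
  | ExecPut a i e s :
      exec W (Put a i e) s (expr_cost i + expr_cost e).+1
        (set_arr s a (eval W s i) (eval W s e))
  | ExecSeq c1 c2 s k1 s1 k2 s2 :
      exec W c1 s k1 s1 -> exec W c2 s1 k2 s2 ->
      exec W (Seq c1 c2) s (k1 + k2) s2
  | ExecIf e c1 c2 s k s' :
      exec W (if eval W s e != 0 then c1 else c2) s k s' ->
      exec W (If e c1 c2) s (expr_cost e + k).+1 s'
  | ExecWhileStop e c s :
      eval W s e = 0 -> exec W (While e c) s (expr_cost e).+1 s
  | ExecWhileLoop e c s k1 s1 k2 s2 :
      eval W s e <> 0 -> exec W c s k1 s1 -> exec W (While e c) s1 k2 s2 ->
      exec W (While e c) s (expr_cost e + k1 + k2).+1 s2.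

(** * Temporal graphs as inputs *)

(* es lists the pairs (e, t) with 1 <= t <= tau and e an edge of layer t, each
   of them once, in any order; the edge e = {u, v} is written (u, v) or
   (v, u). *)
Definition lists_time_edges (V : finType) (G : temporal_graph V) (tau : nat)
    (es : seq (V * V * nat)) : Prop :=
  forall u v t,
    count_mem (u, v, t) es + count_mem (v, u, t) es
      = ((0 < t <= tau) && G t u v).

(* Registers 0, 1, 2 hold the number of vertices, the number of time edges and
   the lifetime; arrays 0, 1, 2 hold the two end points (numbered by num) and
   the times of the time edges; all other memory is 0. *)
Definition input_store (V : finType) (num : V -> 'I_#|V|) (tau : nat)
    (es : seq (V * V * nat)) : store :=
  Store
    (nth 0 [:: #|V|; size es; tau])
    (fun a => nth 0 (nth [::]
       [:: [seq nat_of_ord (num e.1.1) | e <- es];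
           [seq nat_of_ord (num e.1.2) | e <- es];
           [seq e.2 | e <- es]] a)).

(* The running time is measured against the number of vertices plus the number
   of time edges. A word holds the lifetime and all numbers up to a constant
   times that size, i.e. its length is logarithmic in the input. The two
   positions of the profile are returned in registers 0 and 1. *)
Definition nash_in_linear_time (P : cmd) (c : nat) (V : finType)
    (G : temporal_graph V) : Prop :=
  forall (num : V -> 'I_#|V|) (tau : nat) (es : seq (V * V * nat)) (W : nat),
    injective num -> is_lifetime G tau -> lists_time_edges G tau es ->
    c * (#|V| + size es) < W -> tau < W ->
    exists (k : nat) (s : store) (p1 p2 : V),
      [/\ exec W P (input_store num tau es) k s,
          k <= c * (#|V| + size es),
          var s 0 = num p1,
          var s 1 = num p2 &
          nash_equilibrium G p1 p2].

(* Main.v *)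
Require Import Defs.
From mathcomp Require Import all_boot.
From mathcomp Require Import boolp zify.
(* all_boot shadows the constructors [Num] and [Sub] of [expr]. *)
Import Defs.

Set Implicit Arguments.
Unset Strict Implicit.
Unset Printing Implicit Defensive.

(* Against an opponent at [v], a player at [q] can only colour vertices of the
   branch of the tree at [v] that contains [q], and she gets that whole branch
   if [q] is the neighbour of [v] in it, by temporal connectedness. Hence the
   two ends of the edge whose removal splits the tree most evenly form a Nash
   equilibrium: a branch missing one of the two sides and an end of the edge
   could be larger than the other side only if it gave a more even split. The
   times of the edges are irrelevant, so this edge is found from the sizes of
   the subtrees of a breadth-first search tree of the underlying graph. *)

(** * Equilibria at the ends of an edge *)

(** The input is a list of time edges in which an edge of the tree recurs once for each layer up to
    the lifetime that contains it, written either way round. The search therefore runs on half-edges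
    with repetitions, and the marks in [a_seen] absorb the duplicates; its cost is linear in the
    number of time edges. Once a root is fixed, the edges correspond to the vertices other than the
    root: the edge from [x] to its parent cuts off the descendants of [x]. The same sets describe
    the branches at a vertex: the subtrees of its children, and the complement of its own subtree.
    Acyclicity enters through the fact that every edge joins a vertex to its parent, and the rank
    that makes the parent map well-founded is the position in the search queue. *)

Section Game.
Variables (V : finType) (G : temporal_graph V).
Implicit Types (u v w p q : V) (t : nat) (X C : {set V}).

Lemma underlyingP u v t : G t.+1 u v -> underlying G u v.
Proof. by move=> Guv; apply/asboolP; exists t.+1. Qed.

Lemma underlying_sym : symmetric (underlying G).
Proof.
by move=> u v; apply/asboolP/asboolP=> -[t [t_gt0 Gt]]; exists t; rewrite layer_sym.
Qed.

Lemma underlying_irr : irreflexive (underlying G).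
Proof. by move=> u; apply/asboolP=> -[t []]; rewrite layer_irr. Qed.

Lemma diffusion_mono p1 p2 t t' v k :
  t <= t' -> diffusion G p1 p2 t v = Some k -> diffusion G p1 p2 t' v = Some k.
Proof.
move=> /subnK <-; elim: (t' - t) => //= d IHd /IHd.
by rewrite /step => ->.
Qed.

Definition swap_colour (k : colour) : colour :=
  match k with Colour1 => Colour2 | Colour2 => Colour1 | Gray => Gray end.

Lemma diffusion_swap p1 p2 t v :
  diffusion G p2 p1 t v = omap swap_colour (diffusion G p1 p2 t v).
Proof.
elim: t v => [|t IHt] v /=.
  rewrite /start eq_sym; case: (eqVneq p1 p2) => [->|p12]; first by case: eqP.
  have [->|_] := eqVneq v p1; last by case: eqP.
  by rewrite (negPf p12).
have swapE k : has_neighbour G t.+1 (diffusion G p2 p1 t) k v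
             = has_neighbour G t.+1 (diffusion G p1 p2 t) (swap_colour k) v.
  apply: eq_existsb => u; rewrite IHt.
  by case: (diffusion G p1 p2 t u) => [[]|]; case: k.
rewrite /step !swapE IHt /=; case: (diffusion G p1 p2 t v) => //=.
by do 2!case: has_neighbour.
Qed.

Lemma payoff2E p1 p2 : payoff2 G p1 p2 = payoff1 G p2 p1.
Proof.
apply: eq_card => v; rewrite !inE; apply/asboolP/asboolP=> -[t Dt]; exists t.
  by rewrite diffusion_swap Dt.
by move: Dt; rewrite diffusion_swap; case: diffusion => [[]|].
Qed.

Lemma has_neighbourP t col k v :
  reflect (exists2 u, G t v u & col u = Some k) (has_neighbour G t col k v).
Proof.
apply: (iffP existsP) => [[u /andP[Gvu /eqP]]|[u Gvu cu]]; exists u => //.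
by rewrite Gvu cu eqxx.
Qed.

(** The only way out of [X] is through [p2], which holds [Colour2] from time 0 on, so [Colour1]
    never gets past it. *)
Lemma diffusion_Colour1 p1 p2 X t v :
    p1 \in X -> p2 \notin X ->
    (forall x y, x \in X -> y \notin X -> underlying G x y -> y = p2) ->
  diffusion G p1 p2 t v = Some Colour1 -> v \in X.
Proof.
move=> Xp1 X'p2 Xout.
have p12 : p1 != p2 by apply: contraNneq X'p2 => <-.
have p2E s : diffusion G p1 p2 s p2 = Some Colour2.
  by apply: (diffusion_mono (leq0n s)); rewrite /= /start (negPf p12) eq_sym (negPf p12) eqxx.
elim: t v => [|t IHt] v /=.
  rewrite /start (negPf p12).
  by have [->|_] := eqVneq v p1; last case: ifP.
rewrite /step; case Dv: (diffusion _ _ _ t v) => [k|].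
  by case=> Dk; apply: IHt; rewrite Dv Dk.
case: has_neighbourP => [[u Gvu /IHt Xu] _|_]; last by case: ifP.
apply: contraT => X'v; have := Xout u v Xu X'v.
by rewrite underlying_sym => /(_ (underlyingP Gvu)) Ev; rewrite Ev p2E in Dv.
Qed.

Lemma payoff1_le p1 p2 X :
    p1 \in X -> p2 \notin X ->
    (forall x y, x \in X -> y \notin X -> underlying G x y -> y = p2) ->
  payoff1 G p1 p2 <= #|X|.
Proof.
move=> Xp1 X'p2 Xout; apply/subset_leq_card/subsetP=> v; rewrite inE.
by case/asboolP=> t; apply: diffusion_Colour1.
Qed.

Lemma payoff1_same p : payoff1 G p p = 0.
Proof.
apply: eq_card0 => v; rewrite !inE; apply/asboolP=> -[t].
elim: t v => [|t IHt] v /=; first by rewrite /start eqxx; case: ifP.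
rewrite /step; case Dv: (diffusion _ _ _ t v) => [k|].
  by case=> Dk; apply: (IHt v); rewrite Dv Dk.
by case: has_neighbourP => [[u _ /IHt]|_] //; case: ifP.
Qed.

Definition cut_edge C u v :=
  [/\ u \in C, v \notin C &
      forall x y, x \in C -> y \notin C -> underlying G x y -> x = u /\ y = v].

Lemma cut_edgeC C u v : cut_edge C u v -> cut_edge (~: C) v u.
Proof.
case=> Cu C'v Cuv; split; rewrite ?inE ?Cu // => x y; rewrite !inE negbK => C'x Cy.
by rewrite underlying_sym => /(Cuv _ _ Cy C'x)[].
Qed.

(** Both ends of the only crossing edge are coloured at time 0, so neither colour crosses the cut,
    and on the side of [u] there is no competition. Temporal connectedness then carries [Colour1] to
    all of [C]. *)
Lemma payoff1_cut_edge C u v :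
  temporally_connected G -> cut_edge C u v -> payoff1 G u v = #|C|.
Proof.
move=> conG cutC; have [Cu C'v Cuv] := cutC.
have [_ _ Cvu] := cut_edgeC cutC.
have uv : u != v by apply: contraNneq C'v => <-.
have uE t : diffusion G u v t u = Some Colour1.
  by apply: (diffusion_mono (leq0n t)); rewrite /= /start (negPf uv) eqxx.
have vE t : diffusion G u v t v = Some Colour2.
  apply: (diffusion_mono (leq0n t)).
  by rewrite /= /start (negPf uv) eq_sym (negPf uv) eqxx.
have C1 t x : diffusion G u v t x = Some Colour1 -> x \in C.
  by apply: diffusion_Colour1 => // y z Cy C'z /(Cuv y z Cy C'z)[].
have C2 t x : diffusion G u v t x = Some Colour2 -> x \in ~: C.
  move=> Dx; apply: (@diffusion_Colour1 v u _ t); rewrite ?inE ?Cu //.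
    by move=> y z Cy C'z /(Cvu y z Cy C'z)[].
  by rewrite diffusion_swap Dx.
(* A vertex turning gray would have a [Colour1] neighbour in [C] and a [Colour2] neighbour outside.
   One of these two edges crosses the cut, so the vertex is [u] or [v], which already has a
   colour. *)
have noGray t x : diffusion G u v t x <> Some Gray.
  elim: t x => [|t IHt] x /=; first by rewrite /start (negPf uv); do 2!case: ifP => //.
  rewrite /step; case Dx: (diffusion _ _ _ t x) => [k|].
    by case=> Dk; apply: (IHt x); rewrite Dx Dk.
  case: has_neighbourP => [[y Gxy /C1 Cy]|_]; last by case: ifP.
  case: has_neighbourP => [[z Gxz /C2 C'z]|_] // _.
  have [Cx|C'x] := boolP (x \in C).
    have [|//|xu _] := Cuv x z Cx; first by rewrite inE in C'z.
      exact: underlyingP Gxz.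
    by rewrite xu uE in Dx.
  have [|||xv _] := Cvu x y; rewrite ?inE ?Cy //; first exact: underlyingP Gxy.
  by rewrite xv vE in Dx.
(* The walk may wander outside [C], but it can re-enter only at [u], coloured from the start; along
   an edge inside [C] the colour is passed on in time because the times increase strictly. *)
have reached (w : seq (V * nat)) : temporal_walk G u w -> walk_end u w \in C ->
    diffusion G u v (arrival_time u w) (walk_end u w) <> None.
  rewrite /temporal_walk /walk_end /arrival_time.
  elim/last_ind: w => [|w [x t] IHw] /=; first by rewrite /start (negPf uv) eqxx.
  rewrite rcons_path last_rcons /=; case: (last _ _) IHw => y t0 /= IHw.
  case/and3P=> /IHw{}IHw lt_t0t Gyx Cx.
  case: t lt_t0t Gyx => // t lt_t0t Gyx.
  have [Cy|C'y] := boolP (y \in C); last first.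
    have [|->] := Cuv x y Cx C'y; last by rewrite uE.
    by rewrite underlying_sym; apply: underlyingP Gyx.
  have Dy : diffusion G u v t y = Some Colour1.
    case Dy: (diffusion G u v t0 y) (IHw Cy) (@C2 t0 y) (noGray t0 y) => [[]|] // _.
      by move=> _ _; apply: diffusion_mono Dy.
    by rewrite inE Cy => /(_ erefl).
  rewrite /= /step; case: (diffusion _ _ _ t x) => //.
  rewrite layer_sym in Gyx.
  have /has_neighbourP-> : exists2 z, G t.+1 x z & diffusion G u v t z = Some Colour1.
    by exists y.
  by case: ifP.
apply/eqP; rewrite eqn_leq payoff1_le //; last by move=> y z Cy C'z /(Cuv y z Cy C'z)[].
apply/subset_leq_card/subsetP=> x Cx; rewrite inE; apply/asboolP.
have := conG u x; rewrite /td; case: pselect => // -[a /asboolP[w [walk_w Ew _]]] _.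
exists (arrival_time u w); rewrite -Ew in Cx *.
have := @C2 (arrival_time u w) (walk_end u w).
have := noGray (arrival_time u w) (walk_end u w).
move/(_ _ walk_w Cx): reached.
by case: diffusion => [[]|] // _ _ /(_ erefl); rewrite inE Cx.
Qed.

Definition balance X := minn #|X| #|~: X|.

Lemma balanceC X : balance (~: X) = balance X.
Proof. by rewrite /balance setCK minnC. Qed.

(* [X] plays the role of the branch at [v] containing [q]; as it misses both
   [C] and [v], it would be better balanced than [C] if it were larger. *)
Lemma payoff1_cut_edge_best C u v :
    temporally_connected G -> cut_edge C u v ->
    (forall q, q \notin C -> q != v ->
       exists X, [/\ q \in X, v \notin X, [disjoint X & C],
         forall x y, x \in X -> y \notin X -> underlying G x y -> y = v &
         balance X <= balance C]) ->
  forall q, payoff1 G q v <= payoff1 G u v.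
Proof.
move=> conG cutC brC q; rewrite (payoff1_cut_edge conG cutC).
have [Cu C'v Cuv] := cutC.
have [->|qv] := eqVneq q v; first by rewrite payoff1_same.
have [Cq|/brC[]//] := boolP (q \in C).
  by apply: payoff1_le => // x y Cx C'y /(Cuv x y Cx C'y)[].
move=> X [Xq X'v dXC Xout]; rewrite /balance => balX.
apply: leq_trans (payoff1_le Xq X'v Xout) _.
have : #|v |: C| <= #|~: X|.
  apply/subset_leq_card/subsetP=> x; rewrite !inE => /orP[/eqP->//|Cx].
  by rewrite (disjointFl dXC Cx).
rewrite cardsU1 C'v; lia.
Qed.

Lemma nash_equilibrium_cut_edge C u v :
    temporally_connected G -> cut_edge C u v ->
    (forall q, q \notin C -> q != v ->
       exists X, [/\ q \in X, v \notin X, [disjoint X & C],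
         forall x y, x \in X -> y \notin X -> underlying G x y -> y = v &
         balance X <= balance C]) ->
    (forall q, q \in C -> q != u ->
       exists X, [/\ q \in X, u \notin X, X \subset C,
         forall x y, x \in X -> y \notin X -> underlying G x y -> y = u &
         balance X <= balance C]) ->
  nash_equilibrium G u v.
Proof.
move=> conG cutC brC brC'; split=> q; first exact: (payoff1_cut_edge_best conG cutC).
(* Player 2 is player 1 of the game with the colours swapped, playing on the complement of [C]. *)
rewrite !payoff2E; apply: (payoff1_cut_edge_best conG (cut_edgeC cutC)) => p.
rewrite inE negbK => Cp /(brC' _ Cp)[X [Xp X'u sXC Xout balX]]; exists X.
by split=> //; rewrite ?balanceC // -subsets_disjoint.
Qed.

End Game.

(** * Balanced edges of a rooted tree *)

Section RootedTree.
Variables (V : finType) (e : rel V) (r : V) (rank : V -> nat) (par : V -> V).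
Hypotheses (e_sym : symmetric e) (e_irr : irreflexive e) (tree_e : is_tree e).
Hypothesis par_root : par r = r.
Hypothesis par_rank : forall x, x != r -> rank (par x) < rank x.
Hypothesis par_edge : forall x, x != r -> e x (par x).
Implicit Types w x y z : V.

Definition descendants x : {set V} := [set y | fconnect par y x].

Lemma fconnect_rank x y : fconnect par y x -> (x == y) || (rank x < rank y).
Proof.
move=> /iter_findex<-; elim: (findex _ _ _) => [|k IHk] /=; first by rewrite eqxx.
have [Er|z_nr] := eqVneq (iter k par y) r; first by rewrite Er par_root -Er.
have := par_rank z_nr; case/orP: IHk => [/eqP->->|lt_zy lt_pz]; rewrite ?orbT //.
by rewrite (ltn_trans lt_pz lt_zy) orbT.
Qed.

Lemma fconnect_par_neq x y : y != x -> fconnect par y x -> fconnect par (par y) x.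
Proof.
move=> y_x /iter_findex; case: findex => [/eqP|k]; first by rewrite (negPf y_x).
by rewrite iterSr => <-; apply: fconnect_iter.
Qed.

Lemma fconnect_root x : fconnect par x r.
Proof.
elim/ltn_ind: {x}(rank x) {-2}x (erefl (rank x)) => k IHk x Ek.
have [->|x_nr] := eqVneq x r; first exact: connect0.
apply: connect_trans (fconnect1 _ _) (IHk _ _ (par x) erefl).
by rewrite -Ek par_rank.
Qed.

(** Parent edges alone already connect [x] to [y]. A simple path of two or more of them would close
    up with the edge from [y] to [x] to a cycle, so the path is a single parent edge. *)
Lemma tree_edge_par x y : e x y -> (x != r /\ y = par x) \/ (y != r /\ x = par y).
Proof.
have [_ _ acyclic] := tree_e; move=> exy.
(* The condition [y != z] removes the loop of [par] at the root. *)
pose s := [rel y z | (y != z) && ((par y == z) || (par z == y))].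
have sP y' z : s y' z -> (y' != r /\ z = par y') \/ (z != r /\ y' = par z).
  case/andP=> y_z /orP[]/eqP Ey; [left|right]; split=> //;
    apply: contra_neq y_z => Er; rewrite Er in Ey *; by rewrite -Ey par_root.
have se : subrel s e.
  by move=> y' z /sP[[? ->]|[? ->]]; [|rewrite e_sym]; apply: par_edge.
have s_sym : symmetric s by move=> y' z; rewrite /= eq_sym orbC.
have s_root z : connect s z r.
  apply: connect_sub (fconnect_root z) => {z}z _ /eqP<-.
  by have [{1}->|zp] := eqVneq z (par z); [|apply: connect1; rewrite /= zp eqxx].
have: connect s x y by rewrite (connect_trans (s_root x)) // sym_connect_sym.
case/connectP=> p0 /shortenP[[|z [|z' p]] path_p uniq_p _ Ey]; rewrite {p0}/= in Ey.
- by rewrite Ey e_irr in exy.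
- by apply: sP; rewrite Ey; case/andP: path_p.
case/negP: (acyclic [:: x, z, z' & p] isT); rewrite /ucycleb uniq_p andbT.
rewrite /cycle rcons_path (sub_path se path_p) /= e_sym.
by rewrite Ey in exy.
Qed.

Lemma descendants_cut x y z :
    y \in descendants x -> z \notin descendants x -> e y z ->
  y = x /\ z = par x.
Proof.
rewrite !inE => yx zx /tree_edge_par[[_ Ez]|[_ Ey]]; last first.
  by case/negP: zx; apply: connect_trans yx; rewrite Ey fconnect1.
rewrite Ez in zx *; have [->//|y_x] := eqVneq y x.
by rewrite fconnect_par_neq in zx.
Qed.

Lemma child_fconnect x y : y != x -> fconnect par y x ->
  exists w, [/\ w != r, par w = x & fconnect par y w].
Proof.
move=> y_x /iter_findex; elim: findex => [/eqP|k IHk]; first by rewrite (negPf y_x).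
move=> /= Ex; have [/IHk//|k_x] := eqVneq (iter k par y) x.
exists (iter k par y); split=> //; last exact: fconnect_iter.
by apply: contra_neq k_x => Er; rewrite -Ex Er par_root.
Qed.

Lemma par_notin_descendants x : x != r -> par x \notin descendants x.
Proof.
move=> x_nr; rewrite inE; apply/negP=> /fconnect_rank; have := par_rank x_nr.
by case: eqVneq => [{1}<-|_] /=; rewrite ?ltnn //; lia.
Qed.

Lemma descendants_par x : descendants x \subset descendants (par x).
Proof.
by apply/subsetP=> y; rewrite !inE => /connect_trans; apply; apply: fconnect1.
Qed.

Lemma fconnect_total x y z :
  fconnect par z x -> fconnect par z y -> fconnect par x y || fconnect par y x.
Proof.
move=> /iter_findex <- /iter_findex <-; set i := findex _ _ _; set j := findex _ _ _.
have [le_ij|le_ji] := leqP i j.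
  by rewrite -(subnK le_ij) iterD fconnect_iter.
by rewrite -(subnK (ltnW le_ji)) iterD fconnect_iter orbT.
Qed.

(** Ancestors of a vertex form a chain, so a common descendant would put one sibling below the
    other; their common parent would then lie below its own child, against the rank. *)
Lemma sibling_descendants x y :
    x != r -> y != r -> par x = par y -> x != y ->
  [disjoint descendants x & descendants y].
Proof.
have comparable_eq z t : z != r -> par z = par t -> fconnect par t z -> t = z.
  move=> z_nr Ep tz; apply/eqP; apply: contraT => t_z.
  have := fconnect_par_neq t_z tz; rewrite -Ep => pz.
  by have := par_notin_descendants z_nr; rewrite inE pz.
move=> x_nr y_nr Ep x_y; apply/pred0P=> z /=; rewrite !inE; apply/negP=> /andP[zx zy].
case/orP: (fconnect_total zx zy) => [xy|yx]; case/eqP: x_y.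
  exact: comparable_eq.
by apply/esym/comparable_eq.
Qed.

End RootedTree.

Section MaxBalance.
Variables (V : finType) (G : temporal_graph V).
Variables (r : V) (rank : V -> nat) (par : V -> V).
Hypotheses (treeG : temporal_tree G) (conG : temporally_connected G).
Hypothesis par_root : par r = r.
Hypothesis par_rank : forall x, x != r -> rank (par x) < rank x.
Hypothesis par_edge : forall x, x != r -> underlying G x (par x).

Let e_sym := @underlying_sym V G.
Let e_irr := @underlying_irr V G.

Lemma max_balance_nash u : u != r ->
    (forall w, w != r -> balance (descendants par w) <= balance (descendants par u)) ->
  nash_equilibrium G u (par u).
Proof.
have cutP := descendants_cut e_sym e_irr treeG par_root par_rank par_edge.
have notinP := par_notin_descendants par_root par_rank.
move=> u_nr maxu; set D := descendants par in maxu *.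
apply: (@nash_equilibrium_cut_edge _ _ (D u)) => // [|q Dq q_v|q Dq q_u].
- split; [by rewrite inE connect0 | exact: notinP | exact: cutP].
(* The branch at [par u] containing [q] is the subtree of another child if [q] lies below [par u],
   and the complement of the subtree of [par u] otherwise. *)
- have [Dvq|D'vq] := boolP (q \in D (par u)).
    rewrite inE in Dvq; have [w [w_nr Ew qw]] := child_fconnect par_root q_v Dvq.
    have w_u : w != u by apply: contraNneq Dq => <-; rewrite inE.
    exists (D w); rewrite inE -Ew; split; rewrite ?notinP ?maxu //.
      exact: (sibling_descendants par_root par_rank).
    by move=> x y Dx Dy exy; case: (cutP _ _ _ Dx Dy exy).
  have v_nr : par u != r.
    by apply: contraNneq D'vq => ->; rewrite inE (fconnect_root par_rank).
  exists (~: D (par u)); rewrite balanceC !inE connect0 maxu //; split=> //.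
  - by rewrite inE in D'vq.
  - by rewrite disjoint_sym -subsets_disjoint descendants_par.
  move=> x y; rewrite !inE negbK => Dx Dy; rewrite e_sym => eyx.
  by have [] := cutP (par u) y x; rewrite ?inE.
rewrite inE in Dq; have [w [w_nr Ew qw]] := child_fconnect par_root q_u Dq.
exists (D w); rewrite inE; split; rewrite ?maxu //; last first.
- by rewrite -Ew => x y Dx Dy exy; case: (cutP _ _ _ Dx Dy exy).
- by rewrite -Ew descendants_par.
by rewrite -Ew notinP.
Qed.

End MaxBalance.

(** * Running times of while programs *)

Section Runs.
Variable W : nat.
Implicit Types (c : cmd) (e : expr) (s : store) (Q : store -> Prop).

Definition runs c s (K : nat) Q :=
  exists k s', [/\ exec W c s k s', k <= K & Q s'].

Lemma runs_seq c1 c2 s K1 K2 Q :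
  runs c1 s K1 (fun s' => runs c2 s' K2 Q) -> runs (Seq c1 c2) s (K1 + K2) Q.
Proof.
case=> k1 [s1 [ex1 le1 [k2 [s2 [ex2 le2 Qs2]]]]]; exists (k1 + k2), s2.
by split=> //; [apply: ExecSeq ex1 ex2 | apply: leq_add].
Qed.

Lemma runs_mono c s K K' Q Q' :
  K <= K' -> (forall s', Q s' -> Q' s') -> runs c s K Q -> runs c s K' Q'.
Proof.
move=> leK QQ' [k [s' [exk lek Qs']]]; exists k, s'.
by split; [|apply: leq_trans leK|apply: QQ'].
Qed.

Lemma runs_bind c1 c2 s K1 K2 Q1 Q :
    runs c1 s K1 Q1 -> (forall s', Q1 s' -> runs c2 s' K2 Q) ->
  runs (Seq c1 c2) s (K1 + K2) Q.
Proof. by move=> run1 run2; apply: runs_seq; apply: runs_mono run1. Qed.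

(* Loops have no cost here: [wp] rejects them, see [runs_wp]. *)
Fixpoint cmd_cost c : nat :=
  match c with
  | Skip => 1
  | Assign _ e => (expr_cost e).+1
  | Put _ i e => (expr_cost i + expr_cost e).+1
  | Seq c1 c2 => cmd_cost c1 + cmd_cost c2
  | If e c1 c2 => (expr_cost e + maxn (cmd_cost c1) (cmd_cost c2)).+1
  | While _ _ => 0
  end.

Fixpoint wp c s Q : Prop :=
  match c with
  | Skip => Q s
  | Assign x e => Q (set_var s x (eval W s e))
  | Put a i e => Q (set_arr s a (eval W s i) (eval W s e))
  | Seq c1 c2 => wp c1 s (fun s' => wp c2 s' Q)
  | If e c1 c2 => if eval W s e != 0 then wp c1 s Q else wp c2 s Q
  | While _ _ => False
  end.

Lemma runs_wp c s Q : wp c s Q -> runs c s (cmd_cost c) Q.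
Proof.
elim: c s Q => [|x e|a i e|c1 IH1 c2 IH2|e c1 IH1 c2 IH2|//] s Q /=.
- by move=> Qs; exists 1, s; split=> //; apply: ExecSkip.
- by move=> Qs; do 2!eexists; split; first exact: ExecAssign.
- by move=> Qs; do 2!eexists; split; first exact: ExecPut.
- by move/IH1=> r1; apply: runs_seq; apply: runs_mono r1 => // s' /IH2.
move=> Qs; have: runs (if eval W s e != 0 then c1 else c2) s
                   (maxn (cmd_cost c1) (cmd_cost c2)) Q.
  by case: ifP Qs => _ => [/IH1|/IH2]; apply: runs_mono; rewrite // (leq_maxl, leq_maxr).
case=> k [s' [exk lek Qs']]; exists (expr_cost e + k).+1, s'.
by split; rewrite // ?ltnS ?leq_add2l //; apply: ExecIf.
Qed.

(** The index of the invariant is a variant. The body is free of loops, so a round has a fixed cost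
    and the bound is linear in the initial variant. *)
Lemma runs_while e c (I : nat -> store -> Prop) k s :
    (forall k s, I k s -> eval W s e <> 0 ->
       wp c s (fun s' => exists2 k', k' < k & I k' s')) ->
    I k s ->
  runs (While e c) s ((expr_cost e + cmd_cost c).+1 * k + (expr_cost e).+1)
    (fun s' => eval W s' e = 0 /\ exists k', I k' s').
Proof.
move=> body; elim/ltn_ind: k s => k IHk s Is.
have [e0|/eqP e_neq0] := eqVneq (eval W s e) 0.
  exists (expr_cost e).+1, s; split; [exact: ExecWhileStop | lia |].
  by split=> //; exists k.
have [k1 [s1 [ex1 le1 [k' lt_k'k Is1]]]] := runs_wp (body k s Is e_neq0).
have [k2 [s2 [ex2 le2 Qs2]]] := IHk k' lt_k'k s1 Is1.
exists (expr_cost e + k1 + k2).+1, s2; split=> //; last first.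
  have: (expr_cost e + cmd_cost c).+1 * k'.+1 <= (expr_cost e + cmd_cost c).+1 * k.
    by rewrite leq_mul2l lt_k'k orbT.
  rewrite mulnS; lia.
exact: ExecWhileLoop e_neq0 ex1 ex2.
Qed.

End Runs.

(** * The program *)

Local Notation r_n := 0 (only parsing).
Local Notation r_m := 1 (only parsing).
Local Notation r_j := 3 (only parsing).
Local Notation r_2m := 4 (only parsing).
Local Notation r_qh := 5 (only parsing).
Local Notation r_qt := 6 (only parsing).
Local Notation r_e := 7 (only parsing).
Local Notation r_best := 8 (only parsing).
Local Notation r_arg := 9 (only parsing).
Local Notation r_x := 10 (only parsing).
Local Notation a_src := 0 (only parsing).
Local Notation a_tgt := 1 (only parsing).
Local Notation a_head := 3 (only parsing).
Local Notation a_next := 4 (only parsing).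
Local Notation a_queue := 5 (only parsing).
Local Notation a_par := 6 (only parsing).
Local Notation a_seen := 7 (only parsing).
Local Notation a_size := 8 (only parsing).

Definition mirror_body : cmd :=
  Seq (Put a_src (Add (Var r_m) (Var r_j)) (Get a_tgt (Var r_j)))
  (Seq (Put a_tgt (Add (Var r_m) (Var r_j)) (Get a_src (Var r_j)))
  (Assign r_j (Add (Var r_j) (Num 1)))).

Definition mirror : cmd := While (Lt (Var r_j) (Var r_m)) mirror_body.

(** Half-edge [h] is entered as [h.+1] in the linked lists, so that the 0 of fresh memory means an
    empty list. *)
Definition link_body : cmd :=
  Seq (Put a_next (Add (Var r_j) (Num 1)) (Get a_head (Get a_src (Var r_j))))
  (Seq (Put a_head (Get a_src (Var r_j)) (Add (Var r_j) (Num 1)))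
  (Assign r_j (Add (Var r_j) (Num 1)))).

Definition link : cmd := While (Lt (Var r_j) (Var r_2m)) link_body.

(** Entry 0 of the queue and of the parent array keep their initial 0: the root is the vertex
    numbered 0, and it is its own parent. *)
Definition search_init : cmd :=
  Seq (Assign r_qt (Num 1))
  (Seq (Put a_seen (Num 0) (Num 1))
  (Seq (Put a_size (Num 0) (Num 1))
  (Assign r_e (Get a_head (Num 0))))).

(** The usual nested loops, over the queue and over an adjacency list, are flattened into one: a
    round either follows a half-edge or advances the queue. This makes the body free of loops and
    lets a single variant count the rounds. *)
Definition search_body : cmd :=
  If (Var r_e)
    (Seq (Assign r_x (Get a_tgt (Sub (Var r_e) (Num 1))))
    (Seq (Assign r_e (Get a_next (Var r_e)))
    (If (Get a_seen (Var r_x)) Skip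
      (Seq (Put a_seen (Var r_x) (Num 1))
      (Seq (Put a_queue (Var r_qt) (Var r_x))
      (Seq (Put a_par (Var r_qt) (Var r_qh))
      (Seq (Put a_size (Var r_qt) (Num 1))
      (Assign r_qt (Add (Var r_qt) (Num 1))))))))))
    (Seq (Assign r_qh (Add (Var r_qh) (Num 1)))
    (Assign r_e (Get a_head (Get a_queue (Var r_qh))))).

Definition search : cmd := While (Lt (Var r_qh) (Var r_qt)) search_body.

(** Positions are treated from the end of the queue, so a vertex is met after all its descendants,
    when its size is final. Sizes and parents are indexed by queue positions, not by vertex
    numbers. *)
Definition collect_body : cmd :=
  Seq (Assign r_x (Sub (Var r_n) (Get a_size (Var r_j))))
  (Seq (If (Lt (Get a_size (Var r_j)) (Var r_x))
          (Assign r_x (Get a_size (Var r_j))) Skip)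
  (Seq (If (Lt (Var r_best) (Var r_x))
          (Seq (Assign r_best (Var r_x)) (Assign r_arg (Var r_j))) Skip)
  (Seq (Put a_size (Get a_par (Var r_j))
          (Add (Get a_size (Get a_par (Var r_j))) (Get a_size (Var r_j))))
  (Assign r_j (Sub (Var r_j) (Num 1)))))).

Definition collect : cmd := While (Var r_j) collect_body.

Definition answer : cmd :=
  Seq (Assign 0 (Get a_queue (Var r_arg)))
      (Assign 1 (Get a_queue (Get a_par (Var r_arg)))).

Definition nash_program : cmd :=
  Seq (Assign r_2m (Add (Var r_m) (Var r_m)))
  (Seq mirror
  (Seq (Assign r_j (Num 0))
  (Seq link
  (Seq search_init
  (Seq search
  (Seq (Assign r_j (Sub (Var r_qt) (Num 1)))
  (Seq collect answer))))))).

Section Latest.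
Variables (V : eqType) (r : V) (hs : seq (V * V)).

Let src h := (nth (r, r) hs h).1.

(* One plus the largest [h < k] with source [v], or 0 if there is none: the
   linked list of the half-edges leaving [v], from the point of view of [k]. *)
Fixpoint latest (v : V) (k : nat) : nat :=
  if k is h.+1 then if src h == v then k else latest v h else 0.

Lemma latest_le v k : latest v k <= k.
Proof. by elim: k => //= k IHk; case: eqP => // _; apply: leqW. Qed.

Lemma latest_src v k : latest v k != 0 -> src (latest v k).-1 = v.
Proof. by elim: k => //= k IHk; case: (eqVneq (src k) v). Qed.

Lemma latest_gt h k : h < k -> h < latest (src h) k.
Proof.
elim: k => //= k IHk; rewrite ltnS; case: eqVneq => [_|neq] //.
by rewrite leq_eqVlt => /orP[/eqP Eh|/IHk//]; rewrite Eh eqxx in neq.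
Qed.

End Latest.

Definition blank (s : store) (x a : nat) : Prop :=
  (forall y, x <= y -> var s y = 0) /\ (forall b i, a <= b -> arr s b i = 0).

(** * Building the adjacency lists and searching the graph *)

Section Program.
Variables (V : finType) (num : V -> 'I_#|V|) (r : V) (hs : seq (V * V)) (W : nat).
Hypothesis num_inj : injective num.

Let N := #|V|.
Let M := size hs.
Let src h := (nth (r, r) hs h).1.
Let tgt h := (nth (r, r) hs h).2.

Hypotheses (W_gt : N + M + 1 < W).

Definition edges_stored (M : nat) (s : store) : Prop :=
  forall h, h < M -> arr s a_src h = num (src h) /\ arr s a_tgt h = num (tgt h).

Definition lists_stored (k : nat) (s : store) : Prop :=
  (forall v, arr s a_head (num v) = latest r hs v k) /\
  (forall h, h < k -> arr s a_next h.+1 = latest r hs (src h) h).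

Lemma num_eq u v : (num u == num v :> nat) = (u == v).
Proof. by rewrite -(inj_eq num_inj). Qed.

Definition mirror_inv (m k : nat) (s : store) : Prop :=
  exists j, [/\ j <= m, k = m - j, edges_stored (m + j) s, blank s 5 3 &
             [/\ var s r_n = N, var s r_m = m, var s r_j = j & var s r_2m = M]].

Lemma runs_mirror (m : nat) s : M = m + m ->
    (forall h, h < m -> src (m + h) = tgt h /\ tgt (m + h) = src h) ->
    mirror_inv m m s ->
  runs W mirror s (20 * m + 20) (fun s' =>
    [/\ edges_stored M s', blank s' 5 3, var s' r_n = N & var s' r_2m = M]).
Proof.
move=> EM sym_hs inv0.
apply: runs_mono (runs_while (I := mirror_inv m) (k := m) _ inv0).
- by rewrite /=; lia.
- move=> s' [] /= + [k [j [le_j _ Es bl [En Em Ej E2]]]].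
  rewrite Em Ej => lt_j; split=> //; suff -> : M = m + j by []; lia.
move=> {inv0}k {}s [j [le_j -> Es [bl1 bl2] [En Em Ej E2]]] /=.
rewrite Em Ej => lt_j; have {}lt_j : j < m by lia.
rewrite !modn_small; try lia.
have j_neq : (j == m + j) = false by lia.
have [Ej1 Ej2] := Es j ltac:(lia).
have [sym1 sym2] := sym_hs j lt_j.
rewrite /= j_neq /=; exists (m - j.+1); first by lia.
exists j.+1; split=> //=; last by split=> //; lia.
  move=> h lt_h; rewrite /=; have [->|h_neq] := eqVneq h (m + j).
    by rewrite sym1 sym2 Ej1 Ej2.
  by apply: Es; lia.
split=> [[|[|[|[|y]]]]|[|[|[|b]]]] //=; [exact: bl1 | move=> i; exact: bl2].
Qed.

Definition link_inv (k : nat) (s : store) : Prop :=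
  exists j, [/\ j <= M, k = M - j, edges_stored M s, lists_stored j s &
             [/\ blank s 5 5, var s r_n = N, var s r_j = j & var s r_2m = M]].

Lemma runs_link s : link_inv M s ->
  runs W link s (25 * M + 20) (fun s' =>
    [/\ edges_stored M s', lists_stored M s', blank s' 5 5 & var s' r_n = N]).
Proof.
move=> inv0; apply: runs_mono (runs_while (I := link_inv) (k := M) _ inv0).
- by rewrite /=; lia.
- move=> s' [] /= + [k [j [le_j _ Es Ls [bl En Ej E2]]]].
  rewrite E2 Ej => lt_j; split=> //; suff -> : M = j by []; lia.
move=> {inv0}k {}s [j [le_j -> Es [Lh Ln] [[bl1 bl2] En Ej E2]]] /=.
rewrite E2 Ej => lt_j; have {}lt_j : j < M by lia.
rewrite !modn_small; try lia.
exists (M - j.+1); first by lia.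
exists j.+1; split=> //; last first.
- by split=> //=; [split=> [[|[|[|[|y]]]]|[|[|[|[|[|b]]]]]] //=;
    [exact: bl1 | move=> i; exact: bl2] | lia].
- have [Esj _] := Es j lt_j.
  split=> [v|h lt_h] /=.
    by rewrite Esj num_eq eq_sym Lh; case: (src j == v); lia.
  rewrite addn1 eqSS; have [->|h_neq] := eqVneq h j; first by rewrite Esj Lh.
  by apply: Ln; lia.
Qed.


(* [X] lists the vertices in the queue; the half-edges leaving them that have
   been followed are those leaving [X_i] for [i < qh], and those leaving [X_qh]
   whose number is at least [e]. *)
Definition scanned (X : seq V) (qh e h : nat) : bool :=
  let i := index (src h) X in
  (i < size X) && ((i < qh) || (i == qh) && (e <= h)).

Record queue_stored (X : seq V) (s : store) : Prop := QueueStored {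
  queue_uniq : uniq X;
  queue_gt0 : 0 < size X;
  queue_root : nth r X 0 = r;
  queue_arr : forall i, i < size X -> arr s a_queue i = num (nth r X i);
  queue_par0 : arr s a_par 0 = 0;
  queue_par : forall i, 0 < i < size X -> arr s a_par i < i /\
                (nth r X (arr s a_par i), nth r X i) \in hs;
  queue_size : forall i, i < size X -> arr s a_size i = 1
}.

(** [L] is a ghost list of the half-edges followed so far. Being duplicate-free it has at most [M]
    entries, so a round lowers the measure by advancing [r_qh] or by extending [L]. *)
Record search_inv (k : nat) (s : store) (X : seq V) (L : seq nat) : Prop := SearchInv {
  search_n : var s r_n = N;
  search_best : var s r_best = 0;
  search_arg : var s r_arg = 0;
  search_edges : edges_stored M s;
  search_lists : lists_stored M s;
  search_queue : queue_stored X s;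
  search_qh : var s r_qh <= size X;
  search_qt : var s r_qt = size X;
  search_seen : forall v, (arr s a_seen (num v) != 0) = (v \in X);
  search_cursor : var s r_qh < size X ->
    var s r_e <= M /\ (var s r_e != 0 -> src (var s r_e).-1 = nth r X (var s r_qh));
  search_done : forall h, h < M -> scanned X (var s r_qh) (var s r_e) h -> tgt h \in X;
  search_uniq : uniq L;
  search_log : forall h, h \in L -> (h < M) && scanned X (var s r_qh) (var s r_e) h;
  search_measure : k = (N - var s r_qh) + (M - size L)
}.

Lemma uniq_size_le (X : seq V) : uniq X -> size X <= N.
Proof. by move/card_uniqP<-; apply: max_card. Qed.

Lemma log_size_le (L : seq nat) :
  uniq L -> (forall h, h \in L -> h < M) -> size L <= M.
Proof.
move=> uL ltL; rewrite -[M](size_iota 0); apply: (uniq_leq_size uL) => h /ltL.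
by rewrite mem_iota.
Qed.

Lemma scanned_rcons X qh e h u :
  u \notin X -> qh < size X -> scanned (rcons X u) qh e h = scanned X qh e h.
Proof.
rewrite /scanned -cats1 index_cat size_cat /= => X'u lt_qh.
have [Xh|X'h] := boolP (src h \in X).
  by rewrite index_mem Xh; have := index_mem (src h) X; rewrite Xh; lia.
by rewrite index_mem (negPf X'h); case: eqP => _; lia.
Qed.

(* Following a half-edge moves the cursor from [h.+1] to the next half-edge of
   the list, which adds just [h] to the scanned ones. *)
Lemma scanned_next X qh h0 h :
    uniq X -> qh < size X -> src h0 = nth r X qh ->
  scanned X qh (latest r hs (src h0) h0) h = (h == h0) || scanned X qh h0.+1 h.
Proof.
move=> uX lt_qh src_h0; rewrite /scanned.
have le_next := latest_le r hs (src h0) h0.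
have [->|neq] := eqVneq h h0.
  by rewrite src_h0 index_uniq // eqxx lt_qh -src_h0 le_next orbT.
have [lt_h|] := ltnP h h0; last first.
  move=> le_h; have -> : latest r hs (src h0) h0 <= h by apply: leq_trans le_h.
  by have -> : h0 < h by rewrite ltn_neqAle eq_sym neq.
have -> : (h0 < h) = false by lia.
rewrite andbF orbF; case: (index (src h) X =P qh) => [Eq|]; last by rewrite orbF.
have Xh : src h \in X by rewrite -index_mem Eq.
have Eh : src h = src h0 by rewrite src_h0 -Eq nth_index.
have := latest_gt r hs lt_h; rewrite -/(src h) Eh => lt_next.
have -> : (latest r hs (src h0) h0 <= h) = false by lia.
by rewrite andbF orbF.
Qed.

(** With cursor 0 all half-edges leaving [X_qh] count as scanned; the cursor of the next vertex
    starts above all its half-edges, so none of those is added. *)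
Lemma scanned_shift X qh e h :
    h < M -> (qh.+1 < size X -> e = latest r hs (nth r X qh.+1) M) ->
  scanned X qh.+1 e h = scanned X qh 0 h.
Proof.
rewrite /scanned => lt_h Ee; rewrite andbT ltnS.
case lt_i: (_ < size X) => //=; case: (index (src h) X =P qh.+1) => [Ei|]; last by lia.
rewrite Ee -Ei ?nth_index // -?index_mem //.
have := latest_gt r hs lt_h; rewrite -/(src h); lia.
Qed.

Lemma search_step k s X L :
  search_inv k s X L -> var s r_qh < var s r_qt ->
  wp W search_body s (fun s' => exists2 k', k' < k & exists X' L', search_inv k' s' X' L').
Proof.
case=> En Eb Ea Es [Lh Ln] [uX X_gt0 X0 Eq p0 Ep Ez] le_qh Et See Cur Don uL Log Ek.
rewrite Et => lt_qh; have [le_e src_e] := Cur lt_qh.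
have le_X := uniq_size_le uX; rewrite /=.
have le_L := log_size_le uL (fun h Lh => proj1 (andP (Log h Lh))).
case: eqP => [e0|/eqP e_neq0]; rewrite /= !modn_small; try lia.
  rewrite e0 in Don Log.
  (* At the end of the queue the cursor is read from beyond it; its value is harmless, being
     constrained only while a next vertex exists. *)
  have E h : h < M -> scanned X (var s r_qh).+1
      (arr s a_head (arr s a_queue (var s r_qh).+1)) h = scanned X (var s r_qh) 0 h.
    by move=> lt_h; apply: scanned_shift => // lt_qh1; rewrite Eq // Lh.
  exists ((N - (var s r_qh).+1) + (M - size L)); first by lia.
  exists X, L; split=> //=; rewrite ?addn1 //.
  - move=> lt_qh1; rewrite Eq // Lh; split; first exact: latest_le.
    exact: latest_src.
  - by move=> h lt_h; rewrite E //; apply: Don.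
  by move=> h /Log/andP[lt_h]; rewrite lt_h E.
set h0 := (var s r_e).-1; have Ee : var s r_e = h0.+1 by lia.
have lt_h0 : h0 < M by lia.
have src_h0 := src_e e_neq0; rewrite -/h0 in src_h0.
have [_ tgt_h0] := Es h0 lt_h0.
rewrite subn1 -/h0 tgt_h0 Ee Ln // See.
have E := scanned_next _ uX lt_qh src_h0.
rewrite Ee in Don Log.
(* Logged half-edges are scanned, while the cursor [h0.+1] leaves [h0] unscanned. *)
have L'h0 : h0 \notin L.
  apply/negP=> /Log; rewrite /scanned src_h0 index_uniq // eqxx !ltnn; lia.
have uL' : uniq (h0 :: L) by rewrite /= L'h0.
have Log' h : h \in h0 :: L ->
    (h < M) && scanned X (var s r_qh) (latest r hs (src h0) h0) h.
  by rewrite inE E; case: eqP => [->|_ /Log]; rewrite ?lt_h0.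
have le_L' := log_size_le uL' (fun h Lh => proj1 (andP (Log' h Lh))).
have lt_k : (N - var s r_qh) + (M - size (h0 :: L)) < k.
  by move: le_L'; rewrite Ek /=; lia.
have cur' : latest r hs (src h0) h0 <= M /\ (latest r hs (src h0) h0 != 0 ->
    src (latest r hs (src h0) h0).-1 = nth r X (var s r_qh)).
  split; first by apply: leq_trans (ltnW lt_h0); apply: latest_le.
  by rewrite -src_h0; apply: latest_src.
have [Xu|X'u] := boolP (tgt h0 \in X); eexists; try exact: lt_k.
  exists X, (h0 :: L); split=> //= h lt_h; rewrite E.
  by case/predU1P=> [->//|]; apply: Don.
have uX' : uniq (rcons X (tgt h0)) by rewrite rcons_uniq X'u.
have lt_X := uniq_size_le uX'; rewrite size_rcons in lt_X.
have E' h : scanned (rcons X (tgt h0)) (var s r_qh) (latest r hs (src h0) h0) h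
          = (h == h0) || scanned X (var s r_qh) h0.+1 h.
  by rewrite scanned_rcons // E.
exists (rcons X (tgt h0)), (h0 :: L).
split=> //=; rewrite ?size_rcons ?Et ?addn1 //.
- split; rewrite ?size_rcons //=.
  + by rewrite nth_rcons X_gt0.
  + move=> i lt_i; rewrite nth_rcons; case: (eqVneq i (size X)) => [->|neq].
      by rewrite ltnn.
    have lt_i' : i < size X by lia.
    by rewrite lt_i' Eq.
  + by case: eqP => // X0'; rewrite -X0' in X_gt0.
  + move=> i /andP[i_gt0 lt_i]; rewrite !nth_rcons; case: (eqVneq i (size X)) => [->|neq].
      rewrite lt_qh ltnn -src_h0; split=> //.
      by rewrite /src /tgt -surjective_pairing mem_nth.
    have lt_i' : i < size X by lia.
    have [|lt_p p_hs] := Ep i; first by rewrite i_gt0.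
    by rewrite lt_i' (ltn_trans lt_p lt_i').
  + by move=> i lt_i; case: eqP => // neq; apply: Ez; lia.
- exact: ltnW.
- by move=> v; rewrite num_eq mem_rcons inE; case: (eqVneq v (tgt h0)) => //= _; apply: See.
- by rewrite nth_rcons lt_qh.
- move=> h lt_h; rewrite E' mem_rcons inE => /predU1P[->|sc]; first by rewrite eqxx.
  by rewrite Don ?orbT.
by move=> h /Log'; rewrite E E'.
Qed.

Lemma runs_search s : search_inv (N + M) s [:: r] [::] ->
  runs W search s (60 * (N + M) + 20) (fun s' =>
    exists X, [/\ queue_stored X s', forall h, h < M -> src h \in X -> tgt h \in X &
      [/\ var s' r_n = N, var s' r_qt = size X, var s' r_best = 0 & var s' r_arg = 0]]).
Proof.
move=> inv0; pose I k s := exists X L, search_inv k s X L.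
have {}inv0 : I (N + M) s by exists [:: r], [::].
apply: runs_mono (runs_while _ inv0); first by rewrite /=; lia.
  move=> s' [] /= + [k [X [L inv]]]; case: inv => En Eb Ea _ _ QX le_qh Et _ _ Don _ _ _.
  rewrite Et => ge_qh; have Eqh : var s' r_qh = size X by lia.
  exists X; split=> // h lt_h Xh; apply: Don => //.
  by rewrite /scanned Eqh index_mem Xh.
move=> k s1 [X [L inv]] /= lt_q; apply: search_step inv _.
by case: ltnP lt_q.
Qed.

Lemma search_init_inv s :
    num r = 0 :> nat -> edges_stored M s -> lists_stored M s -> blank s 5 5 -> var s r_n = N ->
  wp W search_init s (fun s' => search_inv (N + M) s' [:: r] [::]).
Proof.
move=> num_r Es [Lh Ln] [bl1 bl2] En; have := Lh r; rewrite num_r => E0.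
rewrite /= mod0n modn_small; try lia.
split=> //=; rewrite ?bl1 //.
- split=> //=; first by case=> // _; rewrite bl2 // num_r.
  + by rewrite bl2.
  + by case.
  by case.
- by move=> v; rewrite inE -num_eq num_r; case: (nat_of_ord (num v) =P 0) => // _; rewrite bl2.
- by rewrite E0; split; [apply: latest_le | apply: latest_src].
- move=> h lt_h; rewrite /scanned /= E0; case: eqVneq => [Er|_] //= le_h.
  by have := latest_gt r hs lt_h; rewrite -/(src h) -Er; lia.
by rewrite /=; lia.
Qed.

End Program.

(** * Subtree sizes and the choice of the most balanced edge *)

Section Collect.
Variables (V : finType) (num : V -> 'I_#|V|) (r : V) (W : nat).
Variables (X : seq V) (P : nat -> nat).

Let N := #|V|.

Hypothesis W_gt : N < W.
Hypotheses (uX : uniq X) (memX : forall v, v \in X) (X0 : nth r X 0 = r).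
Hypotheses (P0 : P 0 = 0) (P_lt : forall i, 0 < i < size X -> P i < i).

(** [P] acts on queue positions, as the array [a_par] does; this is the same map on vertices. *)
Definition parent (v : V) : V := nth r X (P (index v X)).

Let vtx i := nth r X i.

Lemma size_queue : size X = N.
Proof. by rewrite -(card_uniqP uX); apply: eq_card => v; rewrite memX. Qed.

Lemma index_lt v : index v X < N.
Proof. by rewrite -size_queue index_mem. Qed.

Lemma index_vtx i : i < N -> index (vtx i) X = i.
Proof. by rewrite -size_queue => lt_i; apply: index_uniq. Qed.

Lemma vtx_index v : vtx (index v X) = v.
Proof. exact: nth_index. Qed.

Lemma card_V_gt0 : 0 < N.
Proof. exact: leq_ltn_trans (index_lt r). Qed.

Lemma index_root : index r X = 0.
Proof. by rewrite -{1}X0 index_vtx ?card_V_gt0. Qed.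

Lemma parent_root : parent r = r.
Proof. by rewrite /parent index_root P0. Qed.

Lemma P_lt_card i : 0 < i < N -> P i < i.
Proof. by rewrite -size_queue; apply: P_lt. Qed.

Lemma parent_vtx i : i < N -> parent (vtx i) = vtx (P i).
Proof. by move=> lt_i; rewrite /parent index_vtx. Qed.

Lemma index_gt0 v : v != r -> 0 < index v X.
Proof. by rewrite lt0n; apply: contra_neq => i0; rewrite -(vtx_index v) i0. Qed.

Lemma parent_index v : v != r -> index (parent v) X < index v X.
Proof.
move=> v_nr; have lt_P : P (index v X) < index v X.
  by apply: P_lt_card; rewrite index_gt0 ?index_lt.
by rewrite /parent index_vtx // (ltn_trans lt_P) ?index_lt.
Qed.

Let D := descendants parent.

(** Positivity ensures that [r_arg] leaves its initial 0 as soon as there is a vertex other than the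
    root. *)
Lemma balance_descendants_gt0 v : v != r -> 0 < balance (D v).
Proof.
move=> v_nr; rewrite leq_min; apply/andP; split; apply/card_gt0P.
  by exists v; rewrite inE connect0.
exists (parent v); rewrite inE.
exact: (par_notin_descendants parent_root parent_index).
Qed.

Lemma balanceE (C : {set V}) :
  (if #|C| < N - #|C| then #|C| else N - #|C|) = balance C.
Proof. by rewrite /balance [#|~: C|]cardsCs setCK minnE; case: ltnP; lia. Qed.

(* [rep z] is the first vertex with index at most [k] on the way from [z] to
   the root. *)
Record collect_inv (k : nat) (s : store) (rep : V -> V) : Prop := CollectInv {
  collect_lt : k < N;
  collect_n : var s r_n = N;
  collect_j : var s r_j = k;
  collect_par : forall i, i < N -> arr s a_par i = P i;
  collect_queue : forall i, i < N -> arr s a_queue i = num (vtx i);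
  rep_index : forall z, index (rep z) X <= k;
  rep_fconnect : forall z, fconnect parent z (rep z);
  fconnect_rep : forall z x,
    index x X <= k -> fconnect parent z x -> fconnect parent (rep z) x;
  collect_size : forall i, i <= k -> arr s a_size i = #|[set z | rep z == vtx i]|;
  collect_best : forall i, k < i < N -> balance (D (vtx i)) <= var s r_best;
  collect_arg : (var s r_arg = 0 /\ var s r_best = 0) \/
    (0 < var s r_arg < N /\ var s r_best = balance (D (vtx (var s r_arg))))
}.

(** Proper descendants of [vtx k] have index above [k], so none of them can be a representative any
    more: the count at position [k] is the full subtree size. *)
Lemma rep_descendants k s rep : collect_inv k s rep ->
  [set z | rep z == vtx k] = D (vtx k).
Proof.
case=> lt_k _ _ _ _ ri rf fr _ _ _; apply/setP=> z; rewrite !inE.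
apply/eqP/idP=> [<-//|zk]; have := fr z (vtx k); rewrite index_vtx // leqnn => /(_ isT zk).
move/(fconnect_rank parent_root parent_index) => /predU1P[->//|].
by rewrite index_vtx // ltnNge ri.
Qed.

Lemma collect_step k s rep : collect_inv k s rep -> k <> 0 ->
  wp W collect_body s (fun s' => exists2 k', k' < k & exists rep', collect_inv k' s' rep').
Proof.
move=> inv k_neq0; have repD := rep_descendants inv; case: inv.
move=> lt_k En Ej Ep Eq ri rf fr Ez Eb Ea.
have k_gt0 : 0 < k by lia.
have lt_P : P k < k by apply: P_lt_card; rewrite k_gt0.
(* Position [k] is retired: its class merges into that of its parent, which is what adding its size
   to that of [P k] records. *)
pose rep' z := if rep z == vtx k then vtx (P k) else rep z.
have sizeP : #|[set z | rep' z == vtx (P k)]|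
           = #|[set z | rep z == vtx (P k)]| + #|[set z | rep z == vtx k]|.
  rewrite -cardsUI; have -> : [set z | rep z == vtx (P k)] :&: [set z | rep z == vtx k] = set0.
    apply/setP=> z; rewrite !inE; apply/negP=> /andP[/eqP-> /eqP/(congr1 (index^~ X))].
    by rewrite !index_vtx; lia.
  rewrite cards0 addn0; apply: eq_card => z; rewrite !inE /rep'.
  by case: ifP; rewrite ?eqxx ?orbT ?orbF.
have sizeN i : i < k -> i != P k ->
    #|[set z | rep' z == vtx i]| = #|[set z | rep z == vtx i]|.
  move=> lt_i neq; apply: eq_card => z; rewrite !inE /rep'; case: (rep z =P vtx k) => // ->.
  by apply/eqP/eqP=> /(congr1 (index^~ X)); rewrite !index_vtx; lia.
have inv' (s' : store) : [/\ var s' r_n = N, var s' r_j = k.-1,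
      arr s' a_par =1 arr s a_par & arr s' a_queue =1 arr s a_queue] ->
    (forall i, arr s' a_size i = if i == P k then #|[set z | rep' z == vtx (P k)]|
                                 else arr s a_size i) ->
    var s' r_best = maxn (var s r_best) (balance (D (vtx k))) ->
    var s' r_arg = (if var s r_best < balance (D (vtx k)) then k else var s r_arg) ->
  collect_inv k.-1 s' rep'.
  move=> [En' Ej' Ep' Eq'] Ez' Eb' Ea'; split=> //.
  - by lia.
  - by move=> i /Ep <-.
  - by move=> i /Eq <-.
  - move=> z; rewrite /rep'; case: eqP => [_|neq]; first by rewrite index_vtx; lia.
    have := ri z; rewrite leq_eqVlt => /predU1P[Ei|]; last by lia.
    by case: neq; rewrite -Ei vtx_index.
  - move=> z; rewrite /rep'; case: eqP => [Erep|_]; last exact: rf.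
    by rewrite -parent_vtx // -Erep; apply: connect_trans (rf z) (fconnect1 _ _).
  - move=> z x le_x zx; rewrite /rep'; have := fr z x ltac:(lia) zx.
    case: eqP => [->|//]; rewrite -parent_vtx //; apply: fconnect_par_neq.
    by apply/eqP=> /(congr1 (index^~ X)); rewrite index_vtx //; lia.
  - move=> i le_i; rewrite Ez'; case: eqVneq => [->//|neq].
    by rewrite sizeN ?Ez //; lia.
  - move=> i /andP[le_i lt_i]; rewrite Eb' leq_max.
    have [->|neq] := eqVneq i k; first by rewrite leqnn orbT.
    by rewrite Eb //; lia.
  by rewrite Ea' Eb'; case: ltnP => _ //; right; rewrite k_gt0 lt_k.
have lt_k1 : k.-1 < k by lia.
have Ek : arr s a_size k = #|D (vtx k)| by rewrite Ez // repD.
have Esum : arr s a_size (P k) + #|D (vtx k)| = #|[set z | rep' z == vtx (P k)]|.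
  by rewrite sizeP repD (Ez _ (ltnW lt_P)).
rewrite /= Ej En Ep // Ek Esum !modn_small; last 2 first.
- by lia.
- by apply: leq_ltn_trans (max_card _) _; rewrite -/N; lia.
move: (balanceE (D (vtx k))); case: ltnP => _ /= ->; case: (ltnP (var s r_best)) => /= cmp;
  exists k.-1 => //; exists rep'; apply: inv' => //=; rewrite ?Ep ?Ej ?subn1 //;
  by rewrite /maxn ?cmp // ltnNge cmp.
Qed.

Lemma runs_collect s : collect_inv N.-1 s id ->
  runs W collect s (60 * N + 20) (fun s' => exists rep, collect_inv 0 s' rep).
Proof.
move=> inv0; pose I k s := exists rep, collect_inv k s rep.
have {}inv0 : I N.-1 s by exists id.
apply: runs_mono (runs_while _ inv0); first by rewrite /=; lia.
  by move=> s' [] /= j0 [k [rep inv]]; exists rep; have := collect_j inv; rewrite j0 => ->.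
move=> k s1 [rep inv] /= j_neq0; apply: (collect_step inv).
by rewrite -(collect_j inv).
Qed.

Lemma collect_init_inv s :
    (forall i, i < N -> arr s a_par i = P i) ->
    (forall i, i < N -> arr s a_queue i = num (vtx i)) ->
    (forall i, i < N -> arr s a_size i = 1) ->
    [/\ var s r_n = N, var s r_j = N.-1, var s r_best = 0 & var s r_arg = 0] ->
  collect_inv N.-1 s id.
Proof.
clear W_gt P0; have N_gt0 := card_V_gt0; move=> Ep Eq Ez [En Ej Eb Ea]; split=> //; try lia.
  by move=> z; have := index_lt z; lia.
move=> i le_i; rewrite Ez; last by lia.
by rewrite -(cards1 (vtx i)); apply: eq_card => z; rewrite !inE.
Qed.

Lemma collect_max_balance s rep : collect_inv 0 s rep ->
  let a := var s r_arg in
  a = 0 /\ N = 1 \/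
  [/\ a < N, vtx a != r & forall w, w != r -> balance (D w) <= balance (D (vtx a))].
Proof.
clear W_gt.
move=> inv; have N_gt0 := card_V_gt0; have best w : w != r -> balance (D w) <= var s r_best.
  move=> w_nr; rewrite -(vtx_index w); apply: (collect_best inv).
  by rewrite index_gt0 ?index_lt.
case: (collect_arg inv) => [[-> Eb]|[/andP[a_gt0 lt_a] Eb]]; [left|right].
  split=> //; apply/eqP; rewrite eqn_leq N_gt0 andbT leqNgt; apply/negP=> N_gt1.
  have v_nr : vtx 1 != r by apply/eqP=> /(congr1 (index^~ X)); rewrite index_vtx ?index_root.
  by have := best _ v_nr; rewrite Eb leqNgt balance_descendants_gt0.
split=> // [|w /best]; last by rewrite Eb.
by apply/eqP=> /(congr1 (index^~ X)); rewrite index_vtx ?index_root //; lia.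
Qed.

End Collect.

(** * Correctness and running time of the whole program, and existence *)

Section Correctness.
Variables (V : finType) (T : temporal_graph V).

Lemma lists_time_edges_underlying tau (es : seq (V * V * nat)) u v :
    is_lifetime T tau -> lists_time_edges T tau es ->
  ((u, v) \in [seq e.1 | e <- es] ++ [seq (e.1.2, e.1.1) | e <- es])
    = underlying T u v.
Proof.
case=> -[tau_gt0 stable] _ listE; rewrite mem_cat; apply/orP/idP.
  have inE' x y t : (x, y, t) \in es -> underlying T x y.
    rewrite -has_pred1 has_count => es_xyt; apply/asboolP; exists t.
    have := listE x y t; case: andP => [[/andP[t_gt0 _] Txy] _|_ /= E0] //.
    by move: E0 es_xyt => /eqP; rewrite addn_eq0 => /andP[/eqP-> _].
  case=> /mapP[[[x y] t] es_xyt /= [-> ->]]; first exact: inE' es_xyt.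
  by rewrite underlying_sym; apply: inE' es_xyt.
(* Layers after the lifetime repeat layer [tau], so an edge of layer [t] is listed at time [t']. *)
case/asboolP=> t [t_gt0 Tuv]; set t' := minn t tau.
have Tuv' : T t' u v.
  by rewrite /t'; case: (leqP t tau) => [//|/ltnW/stable <-].
have := listE u v t'; have -> : 0 < t' <= tau by lia.
rewrite Tuv' /= => Ecount.
have [es_uv|es_uv] : (u, v, t') \in es \/ (v, u, t') \in es.
  by apply/orP; rewrite -!has_pred1 !has_count -addn_gt0 Ecount.
  by left; apply/mapP; exists (u, v, t').
by right; apply/mapP; exists (v, u, t').
Qed.

(** With [M = 2m] half-edges the bounds add up to 190 per time edge, 120 per vertex and a constant
    of 108, absorbed since there is a vertex. The choice 300 leaves slack, and also makes words
    large enough for no sum to wrap around. *)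
Lemma nash_program_linear :
  temporal_tree T -> temporally_connected T -> nash_in_linear_time nash_program 300 T.
Proof.
move=> treeT conT num tau es W num_inj tauP esP W_gt _.
have [N_gt0 connT _] := treeT.
have [g numK gK] : bijective num by apply: inj_card_bij; rewrite ?card_ord.
pose r := g (Ordinal N_gt0).
have num_r : num r = 0 :> nat by rewrite /r gK.
set m := size es in W_gt *.
pose hs := [seq e.1 | e <- es] ++ [seq (e.1.2, e.1.1) | e <- es].
have size_hs : size hs = m + m by rewrite size_cat !size_map.
have hsE u v : ((u, v) \in hs) = underlying T u v.
  exact: lists_time_edges_underlying tauP esP.
have W_gt' : #|V| + size hs + 1 < W by rewrite size_hs; lia.
have nthE j : j < m -> [/\ nth (r, r) hs j = (nth (r, r, 0) es j).1 &
    nth (r, r) hs (m + j) = ((nth (r, r, 0) es j).1.2, (nth (r, r, 0) es j).1.1)].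
  move=> lt_j; rewrite !nth_cat !size_map lt_j ltnNge leq_addr /= addKn.
  by rewrite !(nth_map (r, r, 0)).
have mirror0 : wp W (Assign r_2m (Add (Var r_m) (Var r_m))) (input_store num tau es)
    (mirror_inv num r hs m m).
  rewrite /= modn_small; last by lia.
  exists 0; rewrite subn0 addn0; split=> //=.
    by move=> h lt_h; have [-> _] := nthE h lt_h; rewrite /= !(nth_map (r, r, 0)).
  split=> [[|[|[|[|[|y]]]]]|[|[|[|b]]]] //=; try by rewrite nth_nil.
  by move=> i _; rewrite !nth_nil.
have sym_hs h : h < m -> (nth (r, r) hs (m + h)).1 = (nth (r, r) hs h).2 /\
    (nth (r, r) hs (m + h)).2 = (nth (r, r) hs h).1.
  by case/nthE=> -> ->.
have [K leK [k [s [exk lek [p1 [p2 [E1 E2 nash]]]]]]] : exists2 K, K <= 300 * (#|V| + m) &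
    runs W nash_program (input_store num tau es) K (fun s =>
      exists p1 p2 : V, [/\ var s 0 = num p1, var s 1 = num p2 & nash_equilibrium T p1 p2]);
  last by exists k, s, p1, p2; split=> //; apply: leq_trans leK.
(* The total cost stays an existential variable, instantiated by chaining the phases and compared
   with the bound at the end. *)
eexists; last first.
  rewrite /nash_program; apply: (runs_bind (runs_wp mirror0)) => s1 inv1.
  apply: (runs_bind (runs_mirror W_gt' size_hs sym_hs inv1)) => {inv1}s1.
  case=> edges1 [bl1 bl1'] En1 E21.
  have link0 : wp W (Assign r_j (Num 0)) s1 (link_inv num r hs (size hs)).
    rewrite /= mod0n; exists 0; split=> //=; rewrite ?subn0 //.
      by split=> // v; rewrite bl1'.
    by split=> //; split=> [[|[|[|[|y]]]]|b i lt_b] //=; [apply: bl1 | rewrite bl1' //; lia].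
  apply: (runs_bind (runs_wp link0)) => {link0}s2 inv2.
  apply: (runs_bind (runs_link num_inj W_gt' inv2)) => {inv2}s2 [edges2 lists2 bl2 En2].
  apply: (runs_bind (runs_wp (search_init_inv num_inj W_gt' num_r edges2 lists2 bl2 En2))).
  move=> s3 inv3; apply: (runs_bind (runs_search num_inj W_gt' inv3)) => {inv3}s3.
  case=> X [QX closedX [En3 Et3 Eb3 Ea3]].
  have [uX X_gt0 X0 Eq P0 Ep Ez] := QX.
  have memX v : v \in X.
    have Xr : r \in X by rewrite -X0 mem_nth.
    have /connectP[p path_p ->] := connT r v.
    elim: p (r) Xr path_p => //= y p IHp x Xx /andP[exy]; apply: IHp.
    rewrite -hsE in exy; have := closedX (index (x, y) hs).
    by rewrite index_mem exy nth_index // => /(_ isT Xx).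
  have P_lt i : 0 < i < size X -> arr s3 6 i < i by case/Ep.
  have sizeX := size_queue uX memX.
  have par_edge v : v != r -> underlying T v (parent r X (arr s3 6) v).
    move=> v_nr; rewrite underlying_sym -hsE /parent.
    have [|_] := Ep (index v X); last by rewrite nth_index.
    by rewrite index_mem memX (index_gt0 memX X0).
  have collect0 : wp W (Assign r_j (Sub (Var r_qt) (Num 1))) s3
      (fun s => collect_inv num r X (arr s3 6) #|V|.-1 s id).
    rewrite /= modn_small; last by lia.
    apply: (collect_init_inv uX memX) => //=.
    - by move=> i lt_i; apply: Eq; rewrite sizeX.
    - by move=> i lt_i; apply: Ez; rewrite sizeX.
    by rewrite Et3 subn1 sizeX.
  apply: (runs_bind (runs_wp collect0)) => {collect0}s5 inv5.
  apply: (runs_bind (runs_collect (ltac:(lia) : #|V| < W) uX memX X0 P0 P_lt inv5))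
    => {inv5}s5 [rep inv5].
  apply: runs_wp; rewrite /=.
  (* A tree with a single vertex has no edge to choose; its only profile is an equilibrium. *)
  have [[Ea V1]|[lt_a a_nr maxa]] := collect_max_balance uX memX X0 P0 P_lt inv5.
    exists r, r; rewrite Ea (collect_par inv5) // P0 (collect_queue inv5) // X0; split=> //.
    have Er q : q = r.
      rewrite -(nth_index r (memX q)); have := index_lt uX memX q; rewrite V1.
      by case: index.
    by split=> q; rewrite (Er q).
  set u := nth r X _ in a_nr maxa; exists u, (parent r X (arr s3 6) u).
  have lt_Pa : arr s3 6 (var s5 r_arg) < #|V|.
    apply: (ltn_trans (P_lt _ _) lt_a); rewrite sizeX lt_a andbT lt0n.
    by apply: contra_neq a_nr => a0; rewrite /u a0 X0.
  rewrite (collect_par inv5) // !(collect_queue inv5) //; split=> //.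
    by rewrite (parent_vtx _ _ uX memX lt_a).
  exact: (max_balance_nash treeT conT (parent_root uX memX X0 P0)
            (parent_index uX memX X0 P_lt) par_edge).
have := N_gt0; rewrite size_hs /=; lia.
Qed.

Lemma lifetime_exists : exists tau, is_lifetime T tau.
Proof.
have ex_tau : exists tau, `[< stabilises T tau >].
  by case: (layer_fin T) => tau /asboolP tauP; exists tau.
case: (ex_minnP ex_tau) => tau /asboolP tauP min_tau; exists tau; split=> //.
by move=> sigma /asboolP/min_tau.
Qed.

Lemma time_edges_exist tau : exists es, lists_time_edges T tau es.
Proof.
(* Comparing ranks selects one of the two orientations of each edge. *)
pose P (x : V * V * 'I_tau.+1) :=
  [&& enum_rank x.1.1 < enum_rank x.1.2, 0 < x.2 & T x.2 x.1.1 x.1.2].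
pose f (x : V * V * 'I_tau.+1) := (x.1, val x.2).
have f_inj : injective f by move=> [x i] [y j] [-> /val_inj->].
exists [seq f x | x <- enum P] => u v t.
rewrite !count_uniq_mem ?(map_inj_uniq f_inj) ?enum_uniq //.
have mem_es x y : ((x, y, t) \in [seq f x | x <- enum P])
    = [&& enum_rank x < enum_rank y, 0 < t <= tau & T t x y].
  apply/mapP/idP => [[[[x' y'] i]]|].
    by rewrite mem_enum => /and3P[/= lt_xy i_gt0 Txy] [-> -> ->]; rewrite lt_xy i_gt0 -ltnS ltn_ord.
  case/and3P=> lt_xy /andP[t_gt0 le_t] Txy; exists (x, y, Ordinal (le_t : t < tau.+1)) => //.
  by rewrite mem_enum; apply/and3P.
rewrite !mem_es (layer_sym T t v u); case: ltngtP => [_|_|/val_inj/enum_rank_inj->] //=.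
  by rewrite addn0.
by rewrite layer_irr !andbF.
Qed.

(** Existence is read off from one run of the program: a numbering, the lifetime, a listing of the
    time edges and a large enough [W] are always available. *)
Lemma nash_equilibrium_exists :
  temporal_tree T -> temporally_connected T -> exists p1 p2, nash_equilibrium T p1 p2.
Proof.
move=> treeT conT; have [tau tauP] := lifetime_exists.
have [es esP] := time_edges_exist tau.
pose W := (300 * (#|V| + size es) + tau).+1.
have [|| k [s [p1 [p2 [_ _ _ _ nash]]]]] :=
  nash_program_linear treeT conT (W := W) (@enum_rank_inj V) tauP esP; rewrite /W; try lia.
by exists p1, p2.
Qed.

End Correctness.

Theorem theorem3 :
  (forall (V : finType) (T : temporal_graph V),
     temporal_tree T -> temporally_connected T ->
     exists p1 p2 : V, nash_equilibrium T p1 p2) /\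
  (exists (P : cmd) (c : nat),
     forall (V : finType) (T : temporal_graph V),
       temporal_tree T -> temporally_connected T ->
       nash_in_linear_time P c T).
Proof.
split=> [V T|]; first exact: nash_equilibrium_exists.
by exists nash_program, 300 => V T; apply: nash_program_linear.
Qed.
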